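(* Let $G=(A,B,E)$ be a normalized matching graph with $|A|\leq|B|$. Then the number of complete matchings from $A$ to $B$ in $G$ is at least $\sqrt{\binom{|B|}{|A|}}$.
   Context: A bipartite graph $G=(A,B,E)$ is a normalized matching graph if for every $X\subseteq A$ we have $|X|/|A|\leq|\Gamma(X)|/|B|$, where $\Gamma(X)$ is the set of neighbours of $X$ in $B$. A complete matching from $A$ to $B$ is a matching in $G$ covering every vertex of $A$. *)

(* Defs.v *)
From HB Require Import structures.
From mathcomp Require Import all_boot all_order all_algebra.

Set Implicit Arguments.
Unset Strict Implicit.
Unset Printing Implicit Defensive.

Import Order.TTheory GRing.Theory Num.Theory.
Local Open Scope ring_scope.

(* A bipartite graph with vertex classes A and B is given by its edge set
   E : {set A * B}. *)
Section BipartiteGraph.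

Variables (A B : finType) (E : {set A * B}).
Implicit Types (X : {set A}) (M : {set A * B}).

Definition neighbours X : {set B} := [set b | [exists a in X, (a, b) \in E]].

(* If A or B is empty, the corresponding quotients are 0 / 0 = 0. *)
Definition normalized_matching_graph : Prop :=
  forall X, #|X|%:R / #|A|%:R <= #|neighbours X|%:R / #|B|%:R :> rat.

(* The two endpoints live in different types, so two edges share a vertex
   exactly when they agree on a component. *)
Definition matching M : bool :=
  (M \subset E) &&
  [forall u in M, forall v in M,
     (u != v) ==> (u.1 != v.1) && (u.2 != v.2)].

Definition complete_matching M : bool :=
  matching M && [forall a, exists b, (a, b) \in M].

Definition complete_matchings : {set {set A * B}} :=
  [set M | complete_matching M].

End BipartiteGraph.

(* Main.v *)
(* Spread the normalized matching property into weights [w] on the edges with all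
   sums 1 at the vertices of A and c = |A| / |B| at the vertices of B; after
   cancelling circulations their support is a forest.  On a forest the number M of
   complete matchings is at least the Bethe bound
     prod_e w^(-w) (1-w)^(1-w) * prod_(b in B) (1-c)^(-(1-c)),
   and the entropy inequality prod p_i^(p_i) <= prod (1-p_i)^(1-p_i) for a
   probability vector p turns this into M >= (1-c)^(-(1-c)|B|) when applied at the
   vertices of A, and into M >= c^(-c|B|) when applied at those of B.  Multiply the
   two bounds: 'C(|B|, |A|) c^|A| (1-c)^(|B|-|A|) is a term of the binomial
   expansion of 1. *)
Require Import Defs.
From mathcomp Require Import all_boot all_order all_algebra.
From mathcomp Require Import zify ring lra.
From mathcomp Require Import reals exp Rstruct.

Set Implicit Arguments.
Unset Strict Implicit.
Unset Printing Implicit Defensive.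

Import Order.TTheory GRing.Theory Num.Theory.
Local Open Scope ring_scope.

(** * Real powers, weighted AM-GM and the entropy inequality *)

Lemma powR_addn (R : realType) (x a b : R) : 0 <= a -> 0 <= b ->
  x `^ (a + b) = x `^ a * x `^ b.
Proof.
move=> a0 b0; have [/eqP|ab] := eqVneq (a + b) 0; last first.
  by rewrite powRD // (negbTE ab).
by rewrite paddr_eq0 // => /andP[/eqP -> /eqP ->]; rewrite addr0 powRr0 mulr1.
Qed.

Lemma powR_sum (R : realType) (I : finType) (P : pred I) (x : R) (p : I -> R) :
  (forall i, P i -> 0 <= p i) ->
  x `^ (\sum_(i | P i) p i) = \prod_(i | P i) x `^ (p i).
Proof.
move=> p0; suff [-> //] : x `^ (\sum_(i | P i) p i) = \prod_(i | P i) x `^ (p i)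
   /\ 0 <= \sum_(i | P i) p i.
elim/big_ind2: _ => [|a b c d [<- a0] [<- b0]|i Pi].
- by rewrite powRr0.
- by rewrite powR_addn // addr_ge0.
- by split=> //; exact: p0.
Qed.

(** Weighted AM-GM for [x / a] and [y / b] with weights proportional to [a] and [b], cleared of
    denominators so that zero values are allowed. *)
Lemma weighted_am_gm (R : realType) (x y a b : R) :
  0 <= x -> 0 <= y -> 0 <= a -> 0 <= b ->
  (a + b) `^ (a + b) * (x `^ a * y `^ b) <=
  (x + y) `^ (a + b) * (a `^ a * b `^ b).
Proof.
move=> x0 y0; rewrite le0r => /predU1P[-> b0|a0].
  rewrite !add0r !powRr0 !mul1r mulrC ler_wpM2r ?powR_ge0 //.
  by rewrite ge0_ler_powR ?nnegrE ?addr_ge0 // lerDr.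
rewrite le0r => /predU1P[->|b0].
  rewrite !addr0 !powRr0 !mulr1 mulrC ler_wpM2r ?powR_ge0 //.
  by rewrite ge0_ler_powR ?nnegrE ?addr_ge0 ?lerDl // ltW.
move: x0; rewrite le0r => /predU1P[->|x0].
  by rewrite powR0 ?gt_eqF // mul0r mulr0 !mulr_ge0 ?powR_ge0.
move: y0; rewrite le0r => /predU1P[->|y0].
  by rewrite (@powR0 _ b) ?gt_eqF // !mulr0 !mulr_ge0 ?powR_ge0.
have ab0 := addr_gt0 a0 b0; have xy0 := addr_gt0 x0 y0.
rewrite -ler_ln ?posrE ?mulr_gt0 ?powR_gt0 //.
rewrite !lnM ?posrE ?mulr_gt0 ?powR_gt0 // !ln_powR.
(* This is [ln u <= u - 1] scaled by [t]; the right-hand sides for [(x, a)] and [(y, b)] add up to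
   0. *)
have key (s t : R) : 0 < s -> 0 < t ->
    t * (ln s + ln (a + b) - ln t - ln (x + y)) <= s * (a + b) / (x + y) - t.
  move=> s0 t0; set u := s * (a + b) / t / (x + y).
  have u0 : 0 < u by rewrite !divr_gt0 ?mulr_gt0.
  have -> : ln s + ln (a + b) - ln t - ln (x + y) = ln u.
    by rewrite !ln_div ?posrE ?divr_gt0 ?mulr_gt0 // lnM ?posrE.
  have : ln u <= u - 1.
    by rewrite -{1}(subrKC 1 u); apply: le_ln1Dx; rewrite ltrBrDr addNr.
  rewrite -(ler_pM2l t0) => /le_trans; apply; rewrite /u le_eqVlt; apply/orP; left.
  by apply/eqP; field; rewrite !gt_eqF.
have := lerD (key x a x0 a0) (key y b y0 b0).
have -> : x * (a + b) / (x + y) - a + (y * (a + b) / (x + y) - b) = 0.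
  by field; rewrite gt_eqF.
lra.
Qed.

(** The Weierstrass product inequality; the induction also carries the nonnegativity of the partial
    sums. *)
Lemma sub_sum_le_prod (R : realDomainType) (I : finType) (P : pred I) (p : I -> R) :
  (forall i, 0 <= p i <= 1) ->
  1 - \sum_(i | P i) p i <= \prod_(i | P i) (1 - p i).
Proof.
move=> p01; suff [] : 1 - \sum_(i | P i) p i <= \prod_(i | P i) (1 - p i) /\
   0 <= \sum_(i | P i) p i by [].
elim/big_rec2: _ => [|i a b Pi [IH b0]]; first by rewrite subr0.
have /andP[pi0 pi1] := p01 i; split; last exact: addr_ge0.
have := ler_wpM2l (_ : 0 <= 1 - p i) IH; rewrite subr_ge0 => /(_ pi1).
by have := mulr_ge0 pi0 b0; lra.
Qed.

(** Writing each exponent 1 - p_i as the sum of the other p_j regroups the right-hand side into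
    factors with exponent p_j and base prod_(i != j) (1 - p_i), which is at least 1 - sum_(i != j)
    p_i = p_j. *)
Lemma powR_self_le_compl (R : realType) (I : finType) (p : I -> R) :
  (forall i, 0 <= p i) -> \sum_i p i = 1 ->
  \prod_i p i `^ p i <= \prod_i (1 - p i) `^ (1 - p i).
Proof.
move=> p0 p1.
have compl i : 1 - p i = \sum_(j | j != i) p j.
  by rewrite -p1 (bigD1 i) //= addrAC subrr add0r.
have p01 i : 0 <= p i <= 1.
  by rewrite p0 /= -subr_ge0 compl sumr_ge0.
have -> : \prod_i (1 - p i) `^ (1 - p i) =
          \prod_j (\prod_(i | i != j) (1 - p i)) `^ p j.
  transitivity (\prod_i \prod_(j | j != i) (1 - p i) `^ p j).
    by apply: eq_bigr => i _; rewrite {2}compl powR_sum.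
  rewrite (exchange_big_dep predT) //=; apply: eq_bigr => j _.
  have powR_prod (P : pred I) : (\prod_(i | P i) (1 - p i)) `^ p j =
      \prod_(i | P i) (1 - p i) `^ p j.
    suff [] : (\prod_(i | P i) (1 - p i)) `^ p j =
      \prod_(i | P i) (1 - p i) `^ p j /\ 0 <= \prod_(i | P i) (1 - p i) by [].
    elim/big_rec2: _ => [|i a b Pi [IH b0]]; first by rewrite powR1.
    have pi0 : 0 <= 1 - p i by rewrite subr_ge0; case/andP: (p01 i).
    by rewrite powRM // IH mulr_ge0.
  by rewrite powR_prod; apply: eq_bigl => i; rewrite eq_sym.
apply: ler_prod => j _; rewrite powR_ge0 /= ge0_ler_powR ?nnegrE //.
  by apply: prodr_ge0 => i _; rewrite subr_ge0; case/andP: (p01 i).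
by rewrite (le_trans _ (sub_sum_le_prod _ p01)) // -compl subKr.
Qed.

(** * Hall's marriage theorem *)

Lemma in_neighbours (A B : finType) (E : {set A * B}) (X : {set A}) b :
  reflect (exists2 a, a \in X & (a, b) \in E) (b \in neighbours E X).
Proof.
rewrite inE; apply: (iffP existsP) => [[a /andP[]]|[a aX ab]]; first by exists a.
by exists a; rewrite aX.
Qed.

Lemma neighbours_del (A B : finType) (E : {set A * B}) (X : {set A}) a b :
  a \notin X -> neighbours (E :\ (a, b)) X = neighbours E X.
Proof.
move=> aX; apply/setP=> c; apply/in_neighbours/in_neighbours => -[x xX].
  by rewrite in_setD1 => /andP[_ ?]; exists x.
move=> xc; exists x => //; rewrite in_setD1 xc andbT xpair_eqE negb_and.
by rewrite (contraNneq _ aX) // => <-.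
Qed.

(* Rado's argument: delete edges while Hall's condition survives.  If deleting
   either of two edges at [a] breaks it, the two deficient sets contradict the
   submodularity of [fun X => #|neighbours E X|]. *)
Lemma hall (A B : finType) (E : {set A * B}) :
  (forall X : {set A}, #|X| <= #|neighbours E X|)%N ->
  exists2 f : A -> B, injective f & forall a, (a, f a) \in E.
Proof.
have [n] := ubnP #|E|; elim: n E => // n IH E ltEn hallE.
(* If every vertex of [A] has at most one edge, Hall's condition on singletons gives the map and on
   pairs its injectivity. *)
have [|] := boolP [forall a, forall b1, forall b2,
  ((a, b1) \in E) && ((a, b2) \in E) ==> (b1 == b2)].
  move=> /'forall_'forall_forallP uniqE.
  have exE a : exists b, (a, b) \in E.
    have := hallE [set a]; rewrite cards1 => /card_gt0P[b /in_neighbours[x]].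
    by rewrite in_set1 => /eqP ->; exists b.
  exists (fun a => xchoose (exE a)) => [a a' eqf|a]; last exact: (xchooseP (exE a)).
  apply/eqP; apply: contraT => neq_aa'; have := hallE [set a; a'].
  rewrite cards2 neq_aa' /= => le2.
  suff : (#|neighbours E [set a; a']| <= #|[set xchoose (exE a)]|)%N.
    by rewrite cards1 => /(leq_trans le2).
  apply: subset_leq_card; apply/subsetP=> b /in_neighbours[x /set2P xaa' xb].
  rewrite in_set1; have := xchooseP (exE a); have := xchooseP (exE a').
  rewrite -eqf; case: xaa' xb => -> xb h' h.
    by have := uniqE a b (xchoose (exE a)); rewrite xb h.
  by have := uniqE a' b (xchoose (exE a)); rewrite xb h'.
move=> /forallPn[a /forallPn[b1 /forallPn[b2]]].
rewrite negb_imply => /andP[/andP[ab1 ab2] b12].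
have try b : (a, b) \in E ->
    (exists2 f : A -> B, injective f & forall a, (a, f a) \in E) \/
    exists2 X : {set A}, a \in X & (#|neighbours (E :\ (a, b)) X| < #|X|)%N.
  move=> ab; have [/forallP h|/forallPn[X]] :=
      boolP [forall X : {set A}, #|X| <= #|neighbours (E :\ (a, b)) X|]%N.
    left; have [|f injf fE] := IH _ _ h; first by rewrite (cardsD1 (a, b)) ab in ltEn.
    by exists f => // x; have := fE x; rewrite in_setD1 => /andP[].
  rewrite -ltnNge => ltX; right; exists X => //.
  (* A deficient set contains [a], since all other sets keep their neighbours. *)
  by apply: contraLR ltX => aX; rewrite -leqNgt neighbours_del.
have [//|[X1 aX1 ltX1]] := try b1 ab1; have [//|[X2 aX2 ltX2]] := try b2 ab2.
set N1 := neighbours _ X1 in ltX1; set N2 := neighbours _ X2 in ltX2.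
(* As [b1 != b2], each deleted edge survives in the other graph, so the union loses no neighbour. *)
have /subset_leq_card cupN : neighbours E (X1 :|: X2) \subset N1 :|: N2.
  apply/subsetP=> b /in_neighbours[x xX xb]; apply/setUP.
  have [eqx|neqx] := eqVneq x a; last first.
    by case/setUP: xX => xX; [left|right]; apply/in_neighbours; exists x;
      rewrite // in_setD1 xb xpair_eqE (negbTE neqx).
  rewrite eqx {x xX eqx} in xb; have [eqb|neqb] := eqVneq b b1.
    right; apply/in_neighbours; exists a => //.
    by rewrite in_setD1 xb xpair_eqE eqb (negbTE b12) andbF.
  left; apply/in_neighbours; exists a => //.
  by rewrite in_setD1 xb xpair_eqE (negbTE neqb) andbF.
(* Away from [a] nothing was deleted. Counting then gives |X1| + |X2| <= |N1| + |N2| + 1, against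
   two strict deficiencies. *)
have /subset_leq_card capN : neighbours E ((X1 :&: X2) :\ a) \subset N1 :&: N2.
  apply/subsetP=> b /in_neighbours[x]; rewrite !inE => /and3P[neqx xX1 xX2] xb.
  apply/andP; split; apply/existsP; exists x;
    by rewrite ?xX1 ?xX2 in_setD1 xb xpair_eqE (negbTE neqx).
have := cardsUI X1 X2; have := cardsUI N1 N2.
have := hallE (X1 :|: X2); have := hallE ((X1 :&: X2) :\ a).
have := cardsD1 a (X1 :&: X2); rewrite in_setI aX1 aX2 /=.
lia.
Qed.

(** * Circulations and weights supported on a forest *)

(* A graph with vertex type [V] and edge type [E] is given by the map [ends],
   whose values are two-element sets.  A set of edges is a forest if each of
   its nonempty subsets has a vertex of degree one. *)
Definition forest (E V : finType) (ends : E -> {set V}) (F : {set E}) : bool :=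
  [forall G : {set E}, (G \subset F) && (G != set0) ==>
     [exists x, #|[set e in G | x \in ends e]| == 1%N]].

(* The incidence matrix of [G] has at least as many rows as nonzero columns, and
   the signed bipartition [sg] is a linear dependency between its columns. *)
Lemma exists_circulation (R : fieldType) (E V : finType) (ends : E -> {set V})
    (sg : V -> R) (G : {set E}) :
  (forall e, #|ends e| = 2%N) ->
  (forall x, sg x != 0) -> (forall e, \sum_(x in ends e) sg x = 0) ->
  G != set0 -> (forall x, #|[set e in G | x \in ends e]| != 1%N) ->
  exists d : E -> R, [/\ forall e, e \notin G -> d e = 0,
    exists e, d e != 0 & forall x, \sum_(e | x \in ends e) d e = 0].
Proof.
move=> ends2 sg0 sg_ends /set0Pn[e0 e0G] deg1.
pose W := \bigcup_(e in G) ends e.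
(* Double counting: every vertex met by [G] has degree at least 2, and every edge has two ends. *)
have leWG : (#|W| <= #|G|)%N.
  have : (\sum_(x in W) 2 <= \sum_(e in G) #|ends e|)%N.
    have -> : (\sum_(e in G) #|ends e| =
              \sum_(x : V) #|[set e in G | x \in ends e]|)%N.
      under eq_bigr do rewrite -sum1_card big_mkcond /=.
      rewrite exchange_big; apply: eq_bigr => x _ /=.
      rewrite -big_mkcondr /= -sum1_card; apply: eq_bigl => e.
      by rewrite inE.
    rewrite [X in (_ <= X)%N](bigID (mem W)) /=; apply: leq_trans (leq_addr _ _).
    apply: leq_sum => x /bigcupP[e eG xe].
    have : (0 < #|[set e in G | x \in ends e]|)%N.
      by apply/card_gt0P; exists e; rewrite inE eG.
    by have := deg1 x; case: #|_| => [|[|]].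
  rewrite (eq_bigr _ (fun e _ => ends2 e)).
  by rewrite !sum_nat_const leq_pmul2r.
pose N : 'M[R]_(#|G|, #|W|) :=
  \matrix_(i, j) (enum_val j \in ends (enum_val i))%:R.
pose sgv : 'cV[R]_#|W| := \col_j sg (enum_val j).
have Nsg : N *m sgv = 0.
  apply/matrixP=> i j; rewrite !mxE.
  under eq_bigr do rewrite !mxE mulr_natl mulrb.
  rewrite -(big_enum_val (fun x => if x \in ends (enum_val i) then sg x else 0)).
  rewrite -big_mkcondr /= -[RHS](sg_ends (enum_val i)); apply: eq_bigl => x.
  apply: andb_idl => xi; apply/bigcupP; exists (enum_val i) => //.
  exact: enum_valP.
(* Independent rows would force |W| = |G| and make [N] invertible, yet it kills the nonzero vector
   [sgv]. The circulation is read off the left kernel. *)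
have : ~~ row_free N.
  apply/negP => /eqP rkN.
  have eqWG : #|W| = #|G|.
    by apply/eqP; rewrite eqn_leq leWG -{1}rkN rank_leq_col.
  have /row_fullP[B BN] : row_full N by rewrite /row_full rkN eqWG.
  have sgv0 : sgv = 0 by rewrite -(mul1mx sgv) -BN -mulmxA Nsg mulmx0.
  have /card_gt0P[x xe0] : (0 < #|ends e0|)%N by rewrite ends2.
  have xW : x \in W by apply/bigcupP; exists e0.
  have /matrixP/(_ (enum_rank_in xW x) 0) := sgv0.
  by rewrite !mxE enum_rankK_in // => /eqP; rewrite (negbTE (sg0 x)).
rewrite -kermx_eq0 => /rowV0Pn[v /sub_kermxP vN v0].
pose d e := if e \in G then v 0 (enum_rank_in e0G e) else 0.
have d_val i : d (enum_val i) = v 0 i by rewrite /d enum_valP enum_valK_in.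
exists d; split=> [e eG||x]; first by rewrite /d (negbTE eG).
  have [i vi] : exists i, v 0 i != 0.
    apply/existsP; apply: contraNT v0 => /existsPn v0.
    by apply/eqP/rowP=> i; rewrite mxE; apply/eqP; have := v0 i; rewrite negbK.
  by exists (enum_val i); rewrite d_val.
transitivity (\sum_(e in G) if x \in ends e then d e else 0).
  rewrite [LHS]big_mkcond [RHS]big_mkcond /=; apply: eq_bigr => e _; rewrite /d.
  by case: (e \in G); case: ifP.
have [xW|xW] := boolP (x \in W); last first.
  apply: big1 => e eG; rewrite ifN //; apply: contra xW => xe.
  by apply/bigcupP; exists e.
rewrite big_enum_val /=; move/matrixP/(_ 0 (enum_rank_in xW x)): vN.
rewrite !mxE => vNx; rewrite -[RHS]vNx; apply: eq_bigr => i _.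
by rewrite mxE enum_rankK_in // d_val mulr_natr mulrb.
Qed.

(** A support that is not a forest carries a circulation; adding a suitable multiple keeps all
    vertex sums and makes one weight vanish. Induction on the size of the support. *)
Lemma forest_weights (R : realFieldType) (E V : finType) (ends : E -> {set V})
    (sg : V -> R) (w : E -> R) :
  (forall e, #|ends e| = 2%N) ->
  (forall x, sg x != 0) -> (forall e, \sum_(x in ends e) sg x = 0) ->
  (forall e, 0 <= w e) ->
  exists w' : E -> R, [/\ forall e, 0 <= w' e, forall e, w e = 0 -> w' e = 0,
    forall x, \sum_(e | x \in ends e) w' e = \sum_(e | x \in ends e) w e &
    forest ends [set e | w' e != 0]].
Proof.
move=> ends2 sg0 sg_ends.
have [n] := ubnP #|[set e | w e != 0]|; elim: n w => // n IH w ltn w0.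
have [|/forallPn[G]] := boolP (forest ends [set e | w e != 0]).
  by exists w.
rewrite negb_imply => /andP[/andP[/subsetP GF G0] /existsPn deg1].
have [d [dG [e1 de1] d_sum]] := exists_circulation ends2 sg0 sg_ends G0 deg1.
(* A nonnegative [d] with sum zero at an end of [e1] would vanish at [e1]. *)
have [e2 de2] : exists e, d e < 0.
  have [|de1_ge0] := ltP (d e1) 0; first by exists e1.
  have /card_gt0P[x xe1] : (0 < #|ends e1|)%N by rewrite ends2.
  apply/existsP; apply: contraNT de1 => /existsPn d_ge0.
  have {}d_ge0 e : 0 <= d e by rewrite leNgt d_ge0.
  have := d_sum x => /eqP; rewrite psumr_eq0 // => /allP/(_ e1).
  by rewrite mem_index_enum xe1; apply.
have [e3 de3 e3min] :=
  @arg_minP _ R E e2 (fun e => d e < 0) (fun e => w e / - d e) de2.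
(* The largest multiple that keeps all weights nonnegative; the minimiser [e3] leaves the
   support. *)
pose t := w e3 / - d e3; pose w1 e := w e + t * d e.
have t0 : 0 <= t by rewrite divr_ge0 // oppr_ge0 ltW.
have w1_e3 : w1 e3 = 0.
  by rewrite /w1 /t invrN mulrN mulNr divfK ?subrr // lt_eqF.
have w1_0 e : w e = 0 -> w1 e = 0.
  move=> we; rewrite /w1 we add0r dG ?mulr0 //.
  by apply/negP => /GF; rewrite inE we eqxx.
have w1_ge0 e : 0 <= w1 e.
  rewrite /w1.
  have [de|de] := ltP (d e) 0; last by apply: addr_ge0 (mulr_ge0 _ _).
  have := e3min e de; rewrite -/t ler_pdivlMr ?oppr_gt0 // mulrN.
  by rewrite lerNl -subr_ge0 opprK addrC.
have [|w' [w'_ge0 w'_0 w'_sum w'F]] := IH w1 _ w1_ge0.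
  rewrite -ltnS; apply: leq_trans ltn; rewrite ltnS; apply: proper_card.
  apply/properP; split.
    by apply/subsetP=> e; rewrite !inE; apply: contraNneq => /w1_0 ->.
  exists e3; rewrite !inE ?w1_e3 ?eqxx //.
  have : e3 \in G by apply: contraLR de3 => e3G; rewrite dG ?ltxx.
  by move/GF; rewrite inE.
exists w'; split=> // [e /w1_0/w'_0 //|x].
by rewrite w'_sum big_split /= -mulr_sumr d_sum mulr0 addr0.
Qed.

(** * Weighted matchings and removal of a leaf *)

Definition covered (E V : finType) (ends : E -> {set V}) (m : {set E}) : {set V} :=
  \bigcup_(e in m) ends e.

Definition edge_matching (E V : finType) (ends : E -> {set V}) (m : {set E}) : bool :=
  [forall e in m, forall f in m, (e != f) ==> [disjoint ends e & ends f]].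

Definition matching_weight (R : comNzRingType) (E V : finType) (ends : E -> {set V})
    (y : E -> R) (z : V -> R) (m : {set E}) : R :=
  (\prod_(e in m) y e) * \prod_(x | x \notin covered ends m) z x.

(** The monomer-dimer partition function. Setting [z x = 0] discards the matchings that miss [x];
    general [y] and [z] make the sum stable under leaf removal. *)
Definition matching_sum (R : comNzRingType) (E V : finType) (ends : E -> {set V})
    (F : {set E}) (y : E -> R) (z : V -> R) : R :=
  \sum_(m : {set E} | (m \subset F) && edge_matching ends m)
    matching_weight ends y z m.

Lemma edge_matchingP (E V : finType) (ends : E -> {set V}) (m : {set E}) :
  reflect {in m &, forall e f, e != f -> [disjoint ends e & ends f]}
          (edge_matching ends m).
Proof.
apply: (iffP forall_inP) => [h e f em fm|h e em].
  by move/forall_inP: (h e em) => /(_ f fm)/implyP.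
by apply/forall_inP => f fm; apply/implyP; exact: h.
Qed.

Lemma edge_matchingU1 (E V : finType) (ends : E -> {set V}) (e : E) (m : {set E}) :
  e \notin m -> edge_matching ends (e |: m) =
    edge_matching ends m && [disjoint ends e & covered ends m].
Proof.
move=> em; apply/edge_matchingP/andP => [h|[/edge_matchingP h dis]].
  split; first by apply/edge_matchingP => f g fm gm; apply: h; rewrite in_setU1 ?fm ?gm orbT.
  apply/bigcup_disjointP => f fm; apply: h; rewrite ?in_setU1 ?fm ?eqxx ?orbT //.
  by apply: contraNneq em => ->.
have {}dis f : f \in m -> [disjoint ends e & ends f].
  by move=> fm; move/bigcup_disjointP: dis; apply.
move=> f g /setU1P[->|fm] /setU1P[->|gm] fg; last exact: h.
- by rewrite eqxx in fg.
- exact: dis.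
- by rewrite disjoint_sym dis.
Qed.

(** Let a matching avoid [e0]. If it covers [v], then [u] stays single and its factor [z u] moves to
    the edge at [v]. If not, [u] and [v] either both stay single or are joined by [e0], which gives
    [z u * z v + y e0]. *)
Lemma matching_sum_leaf (R : comNzRingType) (E V : finType) (ends : E -> {set V})
    (F : {set E}) (y : E -> R) (z : V -> R) (e0 : E) (u v : V) :
  e0 \in F -> ends e0 = [set u; v] -> u != v ->
  (forall f, f \in F -> u \in ends f -> f = e0) ->
  matching_sum ends F y z = matching_sum ends (F :\ e0)
    (fun e => if v \in ends e then z u * y e else y e)
    (fun x => if x == u then 1 else if x == v then z u * z v + y e0 else z x).
Proof.
move=> e0F ends0 neq_uv leaf_u; set y' := fun e => _; set z' := fun x => _.
have notin_e0 (m : {set E}) : m \subset F :\ e0 -> e0 \notin m /\ u \notin covered ends m.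
  rewrite subsetD1 => /andP[/subsetP mF e0m]; split=> //.
  by apply/bigcupP => -[f fm uf]; move: e0m; rewrite -(leaf_u f) ?fm ?mF.
rewrite /matching_sum (bigID (fun m : {set E} => e0 \in m)) /= addrC.
rewrite (eq_bigl (fun m : {set E} => (m \subset F :\ e0) && edge_matching ends m));
  last by move=> m; rewrite subsetD1 andbAC.
rewrite [X in _ + X = _](reindex_onto (fun m => e0 |: m) (fun m => m :\ e0)) /=; last first.
  by move=> m /andP[_ e0m]; exact: setD1K.
(* Matchings through [e0] correspond to those of [F :\ e0] missing [v]; the leaf [u] is missed
   anyway. *)
rewrite [X in _ + X = _](eq_bigl (fun m : {set E} => ((m \subset F :\ e0) && edge_matching ends m)
    && (v \notin covered ends m))); last first.
  move=> m; rewrite setU11 andbT subUset sub1set e0F /=.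
  have [e0m|e0m] := boolP (e0 \in m).
    rewrite (_ : _ == m = false) ?andbF; last first.
      by apply/eqP => eqm; move: e0m; rewrite -eqm in_setD1 eqxx.
    by rewrite subsetD1 e0m !andbF.
  rewrite setU1K // eqxx andbT subsetD1 e0m andbT.
  have [mF|//] := boolP (m \subset F); rewrite /= edge_matchingU1 //.
  have [|_ um] := notin_e0 m; first by rewrite subsetD1 mF.
  by rewrite ends0 -setI_eq0 setIUl setU_eq0 !setI_eq0 !disjoints1 um.
rewrite [X in _ + X = _]big_mkcondr -big_split /=; apply: eq_bigr => m /andP[mF mm].
have [e0m um] := notin_e0 m mF; rewrite /matching_weight.
have [vm|vm] := boolP (v \in covered ends m); rewrite /= ?addr0.
  have /bigcupP[f fm vf] := vm.
  rewrite (bigD1 u um) [in RHS](bigD1 u um) (bigD1 f fm) [in RHS](bigD1 f fm) /=.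
  rewrite {1}/y' {1}/z' vf eqxx mul1r.
  have -> : \prod_(e in m | e != f) y' e = \prod_(e in m | e != f) y e.
    apply: eq_bigr => e /andP[em ef]; rewrite /y' ifN //.
    have /edge_matchingP/(_ e f em fm ef) := mm.
    by rewrite disjoint_sym => /disjointFr ->.
  have -> : \prod_(x | (x \notin covered ends m) && (x != u)) z' x =
            \prod_(x | (x \notin covered ends m) && (x != u)) z x.
    apply: eq_bigr => x /andP[xm xu]; rewrite /z' (negbTE xu) ifN //.
    by apply: contraNneq xm => ->.
  ring.
have vmu : (v \notin covered ends m) && (v != u) by rewrite vm eq_sym.
rewrite big_setU1 //= (bigD1 u um) [in RHS](bigD1 u um) /=.
rewrite (bigD1 v vmu) [in RHS](bigD1 v vmu) /=.
rewrite {1 2}/z' eqxx eq_sym (negbTE neq_uv) eqxx mul1r.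
have -> : \prod_(e in m) y' e = \prod_(e in m) y e.
  apply: eq_bigr => e em; rewrite /y' ifN //.
  by apply: contra vm => ve; apply/bigcupP; exists e.
set P := fun x => (x \notin covered ends m) && (x != u) && (x != v).
have -> : \prod_(x | P x) z' x = \prod_(x | P x) z x.
  by apply: eq_bigr => x /andP[/andP[_ xu] xv]; rewrite /z' (negbTE xu) (negbTE xv).
have -> : \prod_(x | x \notin covered ends (e0 |: m)) z x = \prod_(x | P x) z x.
  apply: eq_bigl => x; rewrite /P /covered big_setU1 //= ends0 !inE !negb_or.
  by rewrite andbC -andbA.
ring.
Qed.

(** * The Bethe lower bound on forests *)

Lemma powR_self_gt0 (R : realType) (x : R) : 0 <= x -> 0 < x `^ x.
Proof.
by rewrite le0r => /predU1P[->|x0]; rewrite ?powRr0 ?ltr01 ?powR_gt0.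
Qed.

Lemma forest_sub (E V : finType) (ends : E -> {set V}) (F G : {set E}) :
  G \subset F -> forest ends F -> forest ends G.
Proof.
move=> GF /forallP hF; apply/forallP => H; apply/implyP => /andP[HG H0].
by apply: (implyP (hF H)); rewrite (subset_trans HG GF).
Qed.

Lemma forest_leaf (E V : finType) (ends : E -> {set V}) (F : {set E}) :
  (forall e, #|ends e| = 2%N) -> forest ends F -> F != set0 ->
  exists e u v, [/\ e \in F, ends e = [set u; v], u != v &
    forall f, f \in F -> u \in ends f -> f = e].
Proof.
move=> ends2 /forallP/(_ F); rewrite subxx /= => /implyP h /h/existsP[u /cards1P[e he]].
have : e \in [set e in F | u \in ends e] by rewrite he set11.
rewrite inE => /andP[eF ue]; have /cards1P[v hv] : #|ends e :\ u| == 1%N.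
  by have /eqP := ends2 e; rewrite (cardsD1 u) ue add1n eqSS.
exists e, u, v; split=> //; first by rewrite -hv setD1K.
  by move: (set11 v); rewrite -hv in_setD1 eq_sym => /andP[].
by move=> f fF uf; apply/set1P; rewrite -he inE fF.
Qed.

(** [F] is kept apart from [w] because the induction removes edges while the weights stay fixed. *)
Definition load (R : nmodType) (E V : finType) (ends : E -> {set V}) (w : E -> R)
    (F : {set E}) (x : V) : R :=
  \sum_(e in F | x \in ends e) w e.

(* The Bethe lower bound for a weighted count of matchings.  Removing a leaf
   edge turns it into an instance of the weighted AM-GM inequality. *)
Lemma bethe_bound (R : realType) (E V : finType) (ends : E -> {set V})
    (w : E -> R) (F : {set E}) (y : E -> R) (z : V -> R) :
  (forall e, #|ends e| = 2%N) -> forest ends F ->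
  (forall e, 0 <= w e) -> (forall x, load ends w F x <= 1) ->
  (forall e, 0 <= y e) -> (forall x, 0 <= z x) ->
  \prod_(e in F) y e `^ w e * \prod_(e in F) (1 - w e) `^ (1 - w e) *
    \prod_x z x `^ (1 - load ends w F x) <=
  matching_sum ends F y z * (\prod_(e in F) w e `^ w e *
    \prod_x (1 - load ends w F x) `^
            (1 - load ends w F x)).
Proof.
move=> ends2 + w0; have [n] := ubnP #|F|; elim: n F y z => // n IH F y z ltn forF s1 y0 z0.
pose s := load ends w; rewrite -/s in IH s1 *.
have [F0|Fn0] := eqVneq F set0.
  have s0 x : s set0 x = 0 by rewrite /s /load big1 // => e; rewrite in_set0.
  rewrite F0 !big_set0 !mul1r /matching_sum (big_pred1 set0) => [|m]; last first.
    rewrite subset0; apply: andb_idr => /eqP ->.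
    by apply/edge_matchingP => e f; rewrite in_set0.
  rewrite /matching_weight /covered !big_set0 mul1r.
  rewrite [X in _ * X]big1 => [|x _]; last by rewrite s0 subr0 powR1.
  rewrite mulr1 le_eqVlt; apply/orP; left; apply/eqP.
  apply: eq_big => [x|x _]; first by rewrite in_set0.
  by rewrite s0 subr0 powRr1.
have [e0 [u [v [e0F ends0 neq_uv leaf_u]]]] := forest_leaf ends2 forF Fn0.
rewrite (matching_sum_leaf y z e0F ends0 neq_uv leaf_u).
set y' := fun e => if _ then _ else _; set z' := fun x => if _ then _ else _; set F' := F :\ e0.
have F'F : F' \subset F by rewrite subsetDl.
have vu : v != u by rewrite eq_sym.
have sF' x : s F x = (if x \in ends e0 then w e0 else 0) + s F' x.
  rewrite /s /load; case: ifP => xe0.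
    rewrite (bigD1 e0) ?e0F //=; congr (_ + _); apply: eq_bigl => e.
    by rewrite in_setD1 andbC -andbA.
  rewrite add0r; apply: eq_bigl => e; rewrite in_setD1.
  by case: eqVneq => // ->; rewrite xe0 andbF.
have s_ge0 G x : 0 <= s G x by apply: sumr_ge0.
have s'u : s F' u = 0.
  apply: big1 => e; rewrite in_setD1 -andbA => /and3P[ee0 eF ue].
  by rewrite (leaf_u e eF ue) eqxx in ee0.
have su : s F u = w e0 by rewrite sF' s'u addr0 ends0 set21.
have sv : s F v = w e0 + s F' v by rewrite sF' ends0 set22.
have s'x x : x != u -> x != v -> s F' x = s F x.
  by move=> xu xv; rewrite sF' ends0 !inE (negbTE xu) (negbTE xv) add0r.
have w01 : w e0 <= 1 by rewrite -su.
have y'0 e : 0 <= y' e by rewrite /y'; case: ifP => // _; apply: mulr_ge0.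
have z'0 x : 0 <= z' x.
  rewrite /z'; case: ifP => // _; case: ifP => // _.
  by rewrite addr_ge0 ?mulr_ge0.
have ltF' : (#|F'| < n)%N.
  by rewrite -ltnS; apply: leq_trans ltn; rewrite ltnS [X in (_ < X)%N](cardsD1 e0) e0F.
have s'1 x : s F' x <= 1.
  by apply: le_trans (s1 x); rewrite sF' lerDr; case: ifP.
have := IH F' y' z' ltF' (forest_sub F'F forF) s'1 y'0 z'0.
set Zs := matching_sum _ _ _ _ => {}IH.
have split_F (g : E -> R) : \prod_(e in F) g e = g e0 * \prod_(e in F') g e.
  by rewrite (bigD1 e0) //=; congr (_ * _); apply: eq_bigl => e; rewrite in_setD1 andbC.
have split_V (g : V -> R) :
    \prod_x g x = g u * (g v * \prod_(x | (x != u) && (x != v)) g x).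
  by rewrite (bigD1 u) //= (bigD1 v).
rewrite !split_F !split_V su sv.
move: IH; rewrite !split_V s'u subr0 !powR1 mul1r.
have -> : z' u = 1 by rewrite /z' eqxx.
have -> : z' v = z u * z v + y e0 by rewrite /z' (negbTE vu) eqxx.
rewrite powR1 mul1r.
have -> : \prod_(x | (x != u) && (x != v)) z' x `^ (1 - s F' x) =
          \prod_(x | (x != u) && (x != v)) z x `^ (1 - s F x).
  by apply: eq_bigr => x /andP[xu xv]; rewrite /z' (negbTE xu) (negbTE xv) s'x.
have -> : \prod_(x | (x != u) && (x != v)) (1 - s F' x) `^ (1 - s F' x) =
          \prod_(x | (x != u) && (x != v)) (1 - s F x) `^ (1 - s F x).
  by apply: eq_bigr => x /andP[xu xv]; rewrite s'x.
(* Each edge at [v] has absorbed a factor [z u], and the weights of these edges add up to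
   [s F' v]. *)
have -> : \prod_(e in F') y' e `^ w e =
          \prod_(e in F') y e `^ w e * z u `^ (s F' v).
  rewrite powR_sum // [X in _ * X]big_mkcondr -big_split /=.
  apply: eq_bigr => e _; rewrite /y'; case: ifP => _; last by rewrite mulr1.
  by rewrite powRM // mulrC.
set Y := \prod_(e in F') _; set C := \prod_(e in F') _; set Wp := \prod_(e in F') _.
set Zr := \prod_(x | _) _; set Sr := \prod_(x | _) _.
set a := 1 - (w e0 + s F' v); set p := 1 - s F' v => IH.
have a0 : 0 <= a by rewrite /a -sv subr_ge0.
have p_eq : p = a + w e0 by rewrite /p /a; ring.
(* The new weight [z u * z v + y e0] of [v] is split with exponents [a], the slack left at [v], and
   [w e0]. *)
have := weighted_am_gm (mulr_ge0 (z0 u) (z0 v)) (y0 e0) a0 (w0 e0).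
rewrite -p_eq powRM // => amgm.
have -> : 1 - w e0 = s F' v + a by rewrite /a; ring.
rewrite (powR_addn (z u)) //.
have p0 : 0 <= p by rewrite subr_ge0.
rewrite -(ler_pM2r (powR_self_gt0 p0)).
(* [D] stands on both sides: as the factor of [e0] on the left and of the leaf [u], whose load is
   [w e0], on the right. *)
set D := _ `^ (_ + _).
have D0 : 0 <= D by exact: powR_ge0.
have YCZ0 : 0 <= Y * C * Zr * D * z u `^ s F' v.
  by rewrite !mulr_ge0 ?powR_ge0 //; apply: prodr_ge0 => *; rewrite powR_ge0.
have D1 : 0 <= D * (a `^ a * w e0 `^ w e0) by rewrite !mulr_ge0 ?powR_ge0.
have := ler_wpM2l YCZ0 amgm; have := ler_wpM2l D1 IH.
lra.
Qed.

(** * Edge weights from the normalized matching property *)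

Lemma card_neighbours_ge (A B : finType) (E : {set A * B}) (X : {set A}) :
  normalized_matching_graph E -> (#|A| <= #|B|)%N ->
  (#|X| * #|B| <= #|neighbours E X| * #|A|)%N.
Proof.
move=> hE hAB; have := hE X; have [A0|A0] := posnP #|A|.
  by have := max_card (mem X); rewrite A0 leqn0 => /eqP ->.
have B0 := leq_trans A0 hAB.
rewrite ler_pdivrMr ?ltr0n // mulrAC ler_pdivlMr ?ltr0n //.
by rewrite -!natrM ler_nat.
Qed.

(* Hall's theorem, after replacing each vertex of [A] by [#|B|] copies and each
   vertex of [B] by [#|A|] copies. *)
Lemma normalized_matching_weights (R : realFieldType) (A B : finType) (E : {set A * B}) :
  normalized_matching_graph E -> (#|A| <= #|B|)%N ->
  exists w : A * B -> R, [/\ forall e, 0 <= w e, forall e, e \notin E -> w e = 0,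
    forall a, \sum_b w (a, b) = 1 & forall b, \sum_a w (a, b) = #|A|%:R / #|B|%:R].
Proof.
move=> hE hAB.
pose E' := [set p : (A * 'I_#|B|) * (B * 'I_#|A|) | (p.1.1, p.2.1) \in E].
have [|f injf fE] := @hall _ _ E'.
  move=> X'; pose X := [set p.1 | p in X'].
  (* The neighbours of [X'] are all copies of the neighbours of its projection [X], and [X'] lies
     within the copies of [X]. *)
  have -> : neighbours E' X' = setX (neighbours E X) [set: 'I_#|A|].
    apply/setP=> -[b j]; rewrite in_setX in_setT andbT.
    apply/in_neighbours/in_neighbours => [[[a i] pX']|[a]]; rewrite ?inE /=.
      by exists a => //; apply/imsetP; exists (a, i).
    by case/imsetP => -[a' i] pX' /= -> ab; exists (a', i); rewrite // inE.
  rewrite cardsX cardsT card_ord; apply: leq_trans (card_neighbours_ge X hE hAB).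
  have -> : (#|X| * #|B| = #|setX X [set: 'I_#|B|]|)%N by rewrite cardsX cardsT card_ord.
  apply: subset_leq_card.
  by apply/subsetP=> -[a i] pX'; rewrite in_setX in_setT andbT; apply/imsetP; exists (a, i).
(* The fraction of the copies of [e.1] that are matched to copies of [e.2]. *)
pose w e : R := (\sum_(i < #|B|) ((f (e.1, i)).1 == e.2))%N%:R / #|B|%:R.
(* Both blown-up classes have |A| |B| vertices, so every copy of [b] is used exactly once; this
   gives the sums over [A]. *)
have bijf : bijective f.
  by apply: inj_card_bij => //; rewrite !card_prod !card_ord mulnC.
have sum1_eq (x : B) : (\sum_b (x == b) = 1)%N.
  by rewrite (bigD1 x) //= eqxx big1 // => b; rewrite eq_sym => /negbTE ->.
exists w; split=> [e|[a b] abE|a|b]; rewrite /w /=.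
- by rewrite divr_ge0 ?ler0n.
- rewrite big1 ?mul0r // => i _; apply/eqP; rewrite eqb0.
  by apply: contra abE => /eqP <-; have := fE (a, i); rewrite inE.
- rewrite -mulr_suml -natr_sum exchange_big /=.
  have B0 : (0 < #|B|)%N by apply: leq_trans hAB; apply/card_gt0P; exists a.
  rewrite (eq_bigr (fun=> 1%N)) => [|i _]; last exact: sum1_eq.
  by rewrite sum_nat_const card_ord muln1 divff // pnatr_eq0 -lt0n.
rewrite -mulr_suml -natr_sum pair_big /=; congr (_%:R / _).
transitivity (\sum_(q : B * 'I_#|A|) (q.1 == b))%N.
  by rewrite [RHS](reindex f) /=; [apply: eq_bigr => -[]|exact: onW_bij].
rewrite -(pair_big xpredT xpredT (fun b' _ => (b' == b) : nat)) /= exchange_big /=.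
rewrite (eq_bigr (fun=> 1%N)) => [|i _]; last first.
  by under eq_bigr do rewrite eq_sym; exact: sum1_eq.
by rewrite sum_nat_const card_ord muln1.
Qed.

(** * From the Bethe bound to complete matchings *)

Lemma binomial_weight_le1 (R : realDomainType) (c : R) (n k : nat) :
  0 <= c <= 1 -> (k <= n)%N -> 'C(n, k)%:R * (c ^+ k * (1 - c) ^+ (n - k)) <= 1.
Proof.
move=> /andP[c0 c1] kn; rewrite -[leRHS](expr1n _ n) -[in leRHS](subrK c 1).
rewrite [leRHS]exprDn (bigD1 (Ordinal (kn : k < n.+1)%N)) //= mulr_natl [c ^+ k * _]mulrC.
by rewrite lerDl sumr_ge0 // => i _; rewrite mulrn_wge0 // mulr_ge0 ?exprn_ge0 ?subr_ge0.
Qed.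

Definition bipartite_ends (A B : finType) (e : A * B) : {set A + B} :=
  [set inl e.1; inr e.2].

Lemma card_bipartite_ends (A B : finType) (e : A * B) : #|bipartite_ends e| = 2%N.
Proof. by rewrite cards2. Qed.

Lemma big_bipartite_ends_inl (R : Type) (idx : R) (op : Monoid.com_law idx)
    (A B : finType) (F : A * B -> R) (a : A) :
  \big[op/idx]_(e | inl a \in bipartite_ends e) F e = \big[op/idx]_b F (a, b).
Proof.
rewrite (reindex_onto (fun b => (a, b)) snd) /= => [|[a' b]]; last first.
  by rewrite !inE /= orbF => /eqP[->].
by apply: eq_bigl => b; rewrite !inE /= !eqxx.
Qed.

Lemma big_bipartite_ends_inr (R : Type) (idx : R) (op : Monoid.com_law idx)
    (A B : finType) (F : A * B -> R) (b : B) :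
  \big[op/idx]_(e | inr b \in bipartite_ends e) F e = \big[op/idx]_a F (a, b).
Proof.
rewrite (reindex_onto (fun a => (a, b)) fst) /= => [|[a b']]; last first.
  by rewrite !inE /= => /eqP[->].
by apply: eq_bigl => a; rewrite !inE /= !eqxx.
Qed.

(** The weight 0 on [A] kills every matching that misses a vertex of [A]; each remaining one has
    weight 1 and is complete. *)
Lemma matching_sum_le_complete (R : numDomainType) (A B : finType) (E F : {set A * B}) :
  F \subset E ->
  matching_sum (@bipartite_ends A B) F (fun=> 1)
    (fun x => if x is inl _ then 0 else 1) <= #|complete_matchings E|%:R :> R.
Proof.
move=> FE; rewrite -sum1_card natr_sum /matching_sum big_mkcond [leRHS]big_mkcond /=.
apply: ler_sum => m _; case: ifP => [/andP[mF /edge_matchingP mm]|_]; last by case: ifP.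
rewrite /matching_weight [X in X * _]big1 // mul1r.
have [/forallP cov|/forallPn[a acov]] :=
    boolP [forall a : A, inl a \in covered (@bipartite_ends A B) m]; last first.
  by rewrite (bigD1 (inl a)) //= mul0r; case: ifP.
rewrite big1 => [|[a|//]]; last by rewrite cov.
rewrite ifT // inE; apply/andP; split; last first.
  apply/forallP => a; have /bigcupP[[a' b] abm] := cov a.
  by rewrite !inE orbF => /eqP[->]; apply/existsP; exists b.
rewrite /matching (subset_trans mF FE); apply/forall_inP => e em.
apply/forall_inP => f fm; apply/implyP => ef.
have /disjointFr dis := mm e f em fm ef.
have := dis (inl e.1) (set21 _ _); have := dis (inr e.2) (set22 _ _).
rewrite !in_set2 !(inj_eq inl_inj) !(inj_eq inr_inj).
by move=> /negbT/norP[_ ->] /negbT/norP[-> _].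
Qed.

Lemma binomial_le_complete_matchings (R : realType) (A B : finType) (E : {set A * B}) :
  normalized_matching_graph E -> (#|A| <= #|B|)%N ->
  'C(#|B|, #|A|)%:R <= #|complete_matchings E|%:R ^+ 2 :> R.
Proof.
move=> hE hAB; have [w1 [w1_0 w1E w1_row w1_col]] := normalized_matching_weights R hE hAB.
pose ends := @bipartite_ends A B; pose sg (x : A + B) : R := if x is inl _ then 1 else -1.
have ends2 : forall e, #|ends e| = 2%N := @card_bipartite_ends A B.
have [|e|w [w0 w_w1 w_sum forF]] := forest_weights (sg := sg) ends2 _ _ w1_0.
- by case=> x; rewrite /sg ?oppr_eq0 oner_eq0.
- by rewrite big_setU1 ?inE //= big_set1 /sg addrN.
set F := [set e | w e != 0] in forF; set c : R := #|A|%:R / #|B|%:R in w1_col.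
have w_row a : \sum_b w (a, b) = 1.
  by rewrite -(w1_row a) -!big_bipartite_ends_inl w_sum.
have w_col b : \sum_a w (a, b) = c.
  by rewrite -(w1_col b) -!big_bipartite_ends_inr w_sum.
have FE : F \subset E.
  apply/subsetP => e; rewrite inE; apply: contraNT => /w1E/w_w1 ->.
  exact: eqxx.
(* Both t^t and (1-t)^(1-t) are 1 at t = 0, so products over the support extend to all edges. *)
have prodF (g : R -> R) : g 0 = 1 -> \prod_(e in F) g (w e) = \prod_e g (w e).
  move=> g0; rewrite big_mkcond; apply: eq_bigr => e _; rewrite inE.
  by case: eqVneq => // ->.
have loadE x : load ends w F x = \sum_(e | x \in ends e) w e.
  rewrite /load big_mkcondl; apply: eq_bigr => e _; rewrite inE.
  by case: eqVneq.
have load_l a : load ends w F (inl a) = 1.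
  by rewrite loadE big_bipartite_ends_inl w_row.
have load_r b : load ends w F (inr b) = c.
  by rewrite loadE big_bipartite_ends_inr w_col.
have c0 : 0 <= c by rewrite divr_ge0 ?ler0n.
have c1 : c <= 1.
  (* For empty [B] the quotient [c] is 0 by convention. *)
  have [B0|B0] := posnP #|B|; first by rewrite /c B0 invr0 mulr0 ler01.
  by rewrite ler_pdivrMr ?ltr0n // mul1r ler_nat.
have load1 x : load ends w F x <= 1 by case: x => ?; rewrite ?load_l ?load_r.
pose z (x : A + B) : R := if x is inl _ then 0 else 1.
have z0 x : 0 <= z x by case: x => ?; rewrite /z.
(* The zero weights on [A] do not spoil the left-hand side: the load there is 1, so they enter as
   0^0 = 1. What remains is P <= M Q K. *)
have := bethe_bound ends2 forF w0 load1 (fun=> ler01) z0.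
rewrite (prodF (fun t => (1 - t) `^ (1 - t))) ?subr0 ?powR1 //.
rewrite (prodF (fun t => t `^ t)) ?powRr0 //.
rewrite [X in X * _ * _]big1 //.
rewrite mul1r [X in _ * X <= _]big1 => [|[a|b] _]; last 2 first.
- by rewrite load_l subrr powRr0.
- by rewrite powR1.
rewrite mulr1 big_sumType /=.
rewrite [X in _ * (_ * (X * _))]big1 => [|a _]; last by rewrite load_l subrr powRr0.
under [X in _ * (_ * (_ * X))]eq_bigr do rewrite load_r.
rewrite mul1r prodr_const.
set P := \prod_e _; set Q := \prod_e _; set K := _ ^+ _.
have K_gt0 : 0 < K by rewrite exprn_gt0 // powR_self_gt0 // subr_ge0.
have Q_gt0 : 0 < Q by apply: prodr_gt0 => e _; apply: powR_self_gt0.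
have split_A (g : A * B -> R) : \prod_e g e = \prod_a \prod_b g (a, b).
  by rewrite pair_big; apply: eq_bigr => -[].
have split_B (g : A * B -> R) : \prod_e g e = \prod_b \prod_a g (a, b).
  by rewrite split_A exchange_big.
have QP : Q <= P.
  rewrite /Q /P !split_A; apply: ler_prod => a _.
  rewrite prodr_ge0 => [|b _]; last exact: powR_ge0.
  exact: (powR_self_le_compl (p := fun b => w (a, b))).
pose L := (c `^ c) ^+ #|B|.
have QKPL : Q * K <= P * L.
  rewrite /Q /P /K /L -!prodr_const !split_B -!big_split /=.
  apply: ler_prod => b _.
  apply/andP; split.
    by apply: mulr_ge0 (powR_ge0 _ _); apply: prodr_ge0 => a _; exact: powR_ge0.
  (* The weights at [b] sum only to [c]; an extra outcome of probability [1 - c] completes them and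
     contributes the factors of [K] and [L]. *)
  pose p (x : A + 'I_1) := if x is inl a then w (a, b) else 1 - c.
  have p0 x : 0 <= p x by case: x => ?; rewrite /p ?subr_ge0.
  have := powR_self_le_compl p0; rewrite !big_sumType /= !big_ord1 subKr.
  by apply; rewrite w_col subrKC.
move=> PMQK; set M : R := matching_sum _ _ _ _ in PMQK.
have MK : 1 <= M * K.
  by rewrite -(ler_pM2l Q_gt0) mulr1 mulrCA (le_trans QP).
have L_gt0 : 0 < L by rewrite exprn_gt0 // powR_self_gt0.
(* Chain Q K <= P L <= M Q K L and cancel Q K. *)
have ML : 1 <= M * L.
  rewrite -(ler_pM2l (mulr_gt0 Q_gt0 K_gt0)) mulr1; apply: (le_trans QKPL).
  have := ler_wpM2r (ltW L_gt0) PMQK; lra.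
have cB : c * #|B|%:R = #|A|%:R.
  have [B0|B0] := posnP #|B|; last by rewrite divfK // pnatr_eq0 -lt0n.
  by move: hAB; rewrite B0 leqn0 => /eqP ->; rewrite mulr0.
have L_eq : L = c ^+ #|A| by rewrite /L -!powR_mulrn ?powR_ge0 // -powRrM cB.
have K_eq : K = (1 - c) ^+ (#|B| - #|A|).
  rewrite /K -!powR_mulrn ?powR_ge0 ?subr_ge0 // -powRrM natrB //.
  by rewrite mulrBl mul1r cB.
have := binomial_weight_le1 (_ : 0 <= c <= 1) hAB; rewrite c0 c1 -L_eq -K_eq => /(_ isT) CLK.
have M_le : M <= #|complete_matchings E|%:R by exact: matching_sum_le_complete.
have M0 : 0 <= M by rewrite -(pmulr_lge0 _ K_gt0) (le_trans ler01).
apply: (@le_trans _ _ (M ^+ 2)); last by rewrite lerXn2r // nnegrE ?ler0n.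
have C0 : 0 <= 'C(#|B|, #|A|)%:R :> R by rewrite ler0n.
(* With 'C(|B|, |A|) L K <= 1 this bounds the binomial coefficient by M^2. *)
have h1 : 1 <= M * K * (M * L) by rewrite mulr_ege1.
have h2 := ler_wpM2l C0 h1; have h3 := ler_wpM2l (sqr_ge0 M) CLK.
lra.
Qed.

Theorem theorem4p2 (R : rcfType) (A B : finType) (E : {set A * B})
  (hE : normalized_matching_graph E) (hAB : (#|A| <= #|B|)%N) :
  Num.sqrt ('C(#|B|, #|A|)%:R) <= #|complete_matchings E|%:R :> R.
Proof.
(* The squared bound concerns natural numbers, so it is proved over the real numbers, where real
   powers exist, and carried over to [R]. *)
have := binomial_le_complete_matchings Rdefinitions.R hE hAB.
rewrite -natrX ler_nat => le_sq.
rewrite -[leRHS]ger0_norm ?ler0n // -sqrtr_sqr ler_sqrt ?exprn_ge0 ?ler0n //.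
by rewrite -natrX ler_nat.
Qed.
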